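(* If $\alpha>-1$, $\alpha\ne0$, then \begin{equation*} \langle\!\langle f_\alpha\rangle\!\rangle_{\mathbb R}= \langle\!\langle f_\alpha\rangle\!\rangle_{\mathbb R_+}\cdot \max_{0\le\eta\le1}\psi(\alpha,\eta), \end{equation*} where \begin{equation*} \psi(\alpha,\eta)=\left\{\begin{array}{ll} \displaystyle\frac{\left(1+\eta^{\alpha+1}\right)^{1/\alpha}}{(1+\eta)^{(\alpha+1)/\alpha}}+ \frac{(\alpha+1)^{(\alpha+1)/\alpha}}\alpha \left[\frac1{1+\eta^{\alpha+1}}-\frac1{1+\eta}\right],& \text{ if }\; 0\le\eta\le\eta_1,\\[10pt] \displaystyle 2\frac{\left(1+\eta^{\alpha+1}\right)^{1/\alpha}}{(1+\eta)^{(\alpha+1)/\alpha}},& \text{ if }\; \eta_1\le\eta\le1, \end{array}\right. \end{equation*} and $\eta_1=\eta_1(\alpha)\in(0,1)$ is the root of the equation \begin{equation*} \eta^\alpha=\frac1{1+\alpha(\eta+1)}. \end{equation*}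
   Context: Let $R$ be $\mathbb R$ or $\mathbb R_+=[0,\infty)$. For a non-negative function $f$ locally summable on $R$ and a bounded interval $I\subset R$, set $f_I=\frac1{|I|}\int_I f(x)\,dx$ and $\Omega(f;I)=\frac1{|I|}\int_I|f(x)-f_I|\,dx$. The relative oscillation is $\langle f\rangle_I=\Omega(f;I)/f_I$, and the Gurov--Reshetnyak ''norm'' of $f$ on $R$ is $\langle\!\langle f\rangle\!\rangle_R=\sup_{I\subset R}\langle f\rangle_I$, the supremum over bounded subintervals $I$ of $R$. Let $f_\alpha(x)=|x|^\alpha$ ($x\in\mathbb R$, $\alpha>-1$). (One has $\langle\!\langle f_\alpha\rangle\!\rangle_{\mathbb R_+}=\langle f_\alpha\rangle_{(0,1)}=2|\alpha|/(\alpha+1)^{(\alpha+1)/\alpha}$.) *)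

(* Defs.v *)
From HB Require Import structures.
From mathcomp Require Import all_boot all_order all_algebra.
From mathcomp Require Import all_classical all_reals all_analysis.
Set Implicit Arguments. Unset Strict Implicit. Unset Printing Implicit Defensive.
Import Order.TTheory GRing.Theory Num.Theory.
Import numFieldNormedType.Exports.
Local Open Scope classical_set_scope.
Local Open Scope ring_scope.

Section GR.
Variable R : realType.

Definition mean (f : R -> R) (a b : R) : R :=
  fine (\int[lebesgue_measure]_(x in `[a, b]) (f x)%:E) / (b - a).

Definition Omega (f : R -> R) (a b : R) : R :=
  mean (fun x => `|f x - mean f a b|) a b.

Definition relosc (f : R -> R) (a b : R) : R := Omega f a b / mean f a b.

Definition GRnorm (S : set R) (f : R -> R) : \bar R :=
  ereal_sup [set (relosc f ab.1 ab.2)%:E |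
             ab in [set ab : R * R | ab.1 < ab.2 /\ `[ab.1, ab.2] `<=` S]].

Definition Rplus : set R := [set x | 0 <= x].

Definition falpha (alpha : R) (x : R) : R := `|x| `^ alpha.

Definition psi (alpha eta1 eta : R) : R :=
  if eta <= eta1 then
    (1 + eta `^ (alpha + 1)) `^ (1 / alpha) / (1 + eta) `^ ((alpha + 1) / alpha)
    + (alpha + 1) `^ ((alpha + 1) / alpha) / alpha
      * ((1 + eta `^ (alpha + 1))^-1 - (1 + eta)^-1)
  else
    2 * ((1 + eta `^ (alpha + 1)) `^ (1 / alpha) / (1 + eta) `^ ((alpha + 1) / alpha)).

Definition eta1_eq (alpha eta : R) : Prop :=
  eta `^ alpha = (1 + alpha * (eta + 1))^-1.

End GR.

(* Main.v *)
Require Import Defs.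
From HB Require Import structures.
From mathcomp Require Import all_boot all_order all_algebra.
From mathcomp Require Import all_classical all_reals all_analysis.
From mathcomp Require Import measurable_realfun.
From mathcomp Require Import ring lra.
Import Order.TTheory GRing.Theory Num.Theory.
Import numFieldNormedType.Exports.
Local Open Scope classical_set_scope.
Local Open Scope ring_scope.

(* If the mean of f = |x|^alpha over [a, b] is r^alpha, then f - r^alpha changes
   sign only at |x| = r, so the integral of |f - r^alpha| is twice its integral over
   the subinterval [c, d] where |x| <= r, computed with the primitive of f. The relative oscillation is invariant under dilations and reflection,
   hence only [t, 1] and [-eta, 1] with t, eta in [0, 1] matter.

   On [-eta, 1] the point r satisfies eta <= r iff eta <= eta1, and the two cases
   give the two branches of psi. On [t, 1] the relative oscillation is
   2 |s - (r^p - t^p) / (1 - t^p)| with p = alpha + 1 and r = s + t - s t; since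
   s + t - s t and s t majorize s and t, it is at most 2 |s - s^p|, whose maximum
   over s is the relative oscillation on [0, 1]. The maximum of psi exists because
   its branches are continuous and agree at eta1. *)

(** * Integrals from a primitive, with endpoint singularities allowed *)

Section Primitive.
Set Implicit Arguments. Unset Strict Implicit.
Variable R : realType.
Implicit Types (F g : R -> R) (a b c d x : R).
Notation mu := (@lebesgue_measure R).

Lemma integral_itv_cat g a c b : a <= c -> c <= b ->
  measurable_fun setT g -> (forall x, 0 <= g x) ->
  (\int[mu]_(x in `[a, b]) (g x)%:E =
   \int[mu]_(x in `[a, c]) (g x)%:E + \int[mu]_(x in `[c, b]) (g x)%:E)%E.
Proof.
move=> ac cb mg g0.
have mgS (A : set R) : measurable_fun A (EFin \o g).
  by apply/measurable_EFinP; apply: measurable_funTS.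
have -> : `[a, b]%classic = `[a, c[ `|` `[c, b] :> set R.
  by rewrite -itv_bndbnd_setU// bnd_simp.
rewrite ge0_integral_setU//= ?(integral_itv_bndo_bndc (mgS _))//.
- exact: mgS.
- by move=> x _; rewrite lee_fin.
- by apply/disj_setPLR => x /=; rewrite !in_itv/= => /andP[_ xc]; rewrite leNgt xc.
Qed.

(** [g] may be unbounded near the endpoints, so the fundamental theorem is applied on the compact
    intervals [[a + u n, b - u n]]. Monotone convergence handles the integrals and continuity of [F]
    the right-hand sides. *)
Lemma integral_primitive_oo F g a b : a <= b -> continuous F ->
  {in `]a, b[, forall x, 0 <= g x} -> {in `]a, b[, continuous g} ->
  (forall x, x \in `]a, b[ -> is_derive x 1 F (g x)) ->
  (\int[mu]_(x in `[a, b]) (g x)%:E = (F b - F a)%:E)%E.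
Proof.
rewrite le_eqVlt => /predU1P[<- _ _ _ _|ab cF g0 cg dF].
  by rewrite set_itv1 integral_set1 subrr.
have mg : measurable_fun `]a, b[ (EFin \o g).
  apply/measurable_EFinP; apply: open_continuous_measurable_fun => //.
  by move=> x; rewrite inE; exact: cg.
rewrite (integral_itv_bndoo _ _ mg).
(* A third of the length keeps [a + u n < b - u n] already for [n = 0]. *)
pose e := (b - a) / 3.
have e0 : 0 < e by rewrite /e; lra.
pose u (n : nat) : R := e / n.+1%:R.
have u0 n : 0 < u n by rewrite /u divr_gt0.
have ule n : u n <= e by rewrite /u ler_pdivrMr// ler_pMr// ler1n.
have unin : {homo u : m n / (m <= n)%N >-> n <= m}.
  by move=> m n mn; rewrite /u ler_pM2l// lef_pV2 ?posrE// ler_nat.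
have cu : u n @[n --> \oo] --> 0.
  rewrite -[X in _ --> X](mulr0 e); apply: cvgM; first exact: cvg_cst.
  exact: cvg_harmonic.
pose S n := `[a + u n, b - u n]%classic.
have Soo n : S n `<=` `]a, b[.
  move=> x; rewrite /S /= !in_itv/= => /andP[h1 h2].
  by have ? := u0 n; apply/andP; split; lra.
have US : `]a, b[%classic = \bigcup_n S n.
  apply/seteqP; split => [x|x [n _ /Soo]//].
  rewrite /= in_itv/= => /andP[ax xb].
  have [n hn] : exists n, u n < Num.min (x - a) (b - x).
    have m0 : 0 < Num.min (x - a) (b - x) by rewrite lt_min !subr_gt0 ax.
    have := (cvgr_lt _ cu) _ m0 => -[N _ /(_ N (leqnn N))] ?; by exists N.
  exists n => //; rewrite /S/= in_itv/=; move: hn; rewrite lt_min => /andP[]; lra.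
have c1 : (\int[mu]_(x in S n) (g x)%:E @[n --> \oo] -->
    \int[mu]_(x in `]a, b[) (g x)%:E)%E.
  rewrite US; apply: ge0_nondecreasing_set_cvg_integral => //=.
  - move=> m n mn; apply/subsetPset => x; rewrite /S /= !in_itv/=.
    by have := unin _ _ mn; lra.
  - by move=> n; apply: measurable_itv.
  - by move=> n; apply: measurable_funS mg => //; apply: Soo.
  - by move=> n x /Soo xab; rewrite lee_fin g0.
have c2 : ((F (b - u n) - F (a + u n))%:E @[n --> \oo] --> (F b - F a)%:E)%E.
  apply: cvg_EFin; first exact: nearW.
  apply: cvgB.
    apply: continuous_cvg; first exact: cF.
    by rewrite -[X in _ --> X]subr0; apply: cvgB => //; exact: cvg_cst.
  apply: continuous_cvg; first exact: cF.
  by rewrite -[X in _ --> X]addr0; apply: cvgD => //; exact: cvg_cst.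
have E n : (\int[mu]_(x in S n) (g x)%:E = (F (b - u n) - F (a + u n))%:E)%E.
  have oo x : x \in `[a + u n, b - u n] -> x \in `]a, b[ by exact: Soo.
  have ooo x : x \in `]a + u n, b - u n[ -> x \in `]a, b[.
    by move=> h; apply: oo; apply: subset_itv_oo_cc.
  rewrite EFinB; apply: continuous_FTC2.
  - by have := ule n; rewrite /e; lra.
  - apply: continuous_in_subspaceT => x; rewrite inE => /oo; exact: cg.
  - split=> [x /ooo /dF []//||]; apply: cvg_at_right_filter || apply: cvg_at_left_filter; exact: cF.
  - by move=> x /ooo /dF d; rewrite derive1E; apply: derive_val.
by move: c1; under eq_fun do rewrite E; move=> c1; apply: cvg_unique c1 c2.
Qed.

(* The point 0 is excluded because f = |x|^alpha is singular there when alpha < 0,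
   where powR gives it the junk value 0. *)
Lemma integral_primitive F g a b : a <= b -> continuous F ->
  measurable_fun setT g -> (forall x, 0 <= g x) ->
  (forall x, a < x < b -> x != 0 -> {for x, continuous g}) ->
  (forall x, a < x < b -> x != 0 -> is_derive x 1 F (g x)) ->
  (\int[mu]_(x in `[a, b]) (g x)%:E = (F b - F a)%:E)%E.
Proof.
move=> ab cF mg g0 cg dF.
have P u v : u <= v -> (forall x, u < x < v -> (a < x < b) && (x != 0)) ->
    (\int[mu]_(x in `[u, v]) (g x)%:E = (F v - F u)%:E)%E.
  move=> uv H; apply: integral_primitive_oo => // x; rewrite in_itv/= => /H/andP[h1 h2].
    exact: cg.
  exact: dF.
(* If 0 is interior, cutting there makes it an endpoint, where only [F] has to be continuous. *)
have [/andP[a0 b0]|n0] := boolP (a < 0 < b).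
  rewrite (@integral_itv_cat _ _ 0) ?ltW// !P ?ltW//.
  - by rewrite -EFinD; congr EFin; ring.
  - by move=> x /andP[x0 xb]; rewrite xb (lt_trans a0)//= gt_eqF.
  - by move=> x /andP[xa x0]; rewrite xa (lt_trans _ b0)//= lt_eqF.
by apply: P => // x xab; rewrite xab /=; apply: contra n0 => /eqP <-.
Qed.

End Primitive.

(** * The primitive of [|x|^alpha] *)

Section PowerPrimitive.
Set Implicit Arguments. Unset Strict Implicit.
Variables (R : realType) (alpha : R).
Hypothesis alpha_gtN1 : -1 < alpha.
Implicit Types (k m x : R).

(** The odd primitive of [|x|^alpha]. As [alpha + 1 > 0], it stays continuous at 0 even when
    [|x|^alpha] blows up there. *)
Definition pprim x := Num.sg x * `|x| `^ (alpha + 1) / (alpha + 1).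

Let p_gt0 : 0 < alpha + 1. Proof. by rewrite -ltrBlDr sub0r. Qed.
Let p_neq0 : alpha + 1 != 0. Proof. by rewrite gt_eqF. Qed.

Lemma pprimE x : 0 <= x -> pprim x = x `^ (alpha + 1) / (alpha + 1).
Proof.
rewrite le_eqVlt => /predU1P[<-|x0].
  by rewrite /pprim sgr0 powR0// !mul0r.
by rewrite /pprim gtr0_sg// gtr0_norm// mul1r.
Qed.

Lemma pprimN x : pprim (- x) = - pprim x.
Proof. by rewrite /pprim sgrN normrN !mulNr. Qed.

Lemma pprim0 : pprim 0 = 0.
Proof. by rewrite /pprim sgr0 !mul0r. Qed.

Lemma pprimZ k x : 0 < k -> pprim (k * x) = k `^ (alpha + 1) * pprim x.
Proof.
move=> k0; rewrite /pprim sgrM normrM (gtr0_sg k0) (gtr0_norm k0) powRM ?(ltW k0)//.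
by rewrite mul1r !mulrA (mulrC (Num.sg x)).
Qed.

Lemma measurable_falpha : measurable_fun setT (falpha alpha).
Proof.
exact: (measurableT_comp (measurable_powR alpha) (@normr_measurable R setT)).
Qed.

Lemma continuous_falpha x : x != 0 -> {for x, continuous (falpha alpha)}.
Proof.
move=> x0; apply: (@continuous_comp _ _ _ (fun x => `|x|) (fun y => y `^ alpha)).
  exact: norm_continuous.
apply: differentiable_continuous; apply/derivable1_diffP.
by apply: derivable_powR; rewrite in_itv/= andbT normr_gt0.
Qed.

Lemma is_derive_pprim x : x != 0 -> is_derive x 1 pprim (falpha alpha x).
Proof.
wlog x0 : x / 0 < x => [W x_neq0|_].
  have [x0|x0] := ltP 0 x; first exact: W.
  have xN0 : 0 < - x by rewrite oppr_gt0 lt_neqAle x_neq0.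
  have d : is_derive (- x) 1 pprim (falpha alpha (- x)) by apply: W; rewrite ?gt_eqF.
  have -> : pprim = - (pprim \o -%R) by apply/funext => y; rewrite !fctE pprimN opprK.
  apply: is_derive_eq.
  by rewrite /falpha normrN mulrN1 opprK.
have x_nbhs : \forall y \near x, 0 < y by exact: lt_nbhsr.
have d : is_derive x 1 ((alpha + 1)^-1 \*: (fun y : R => y `^ (alpha + 1))) (falpha alpha x).
  apply: (@is_derive_eq _ _ _ _ _ _ _ _ (is_deriveZ _ (is_derive1_powR _ x0))).

  by rewrite addrK scalerA mulVf// scale1r /falpha gtr0_norm.
apply: near_eq_is_derive d.
by apply: filterS x_nbhs => y y0; rewrite pprimE ?ltW// mulrC.
Qed.

Lemma continuous_pprim : continuous pprim.
Proof.
move=> x; have [->|x0] := eqVneq x 0; last first.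
  apply: differentiable_continuous; apply/derivable1_diffP.
  by case: (is_derive_pprim x0).
rewrite /continuous_at pprim0; apply/cvgr0Pnorm_lt => e e0.
near=> y.
rewrite /pprim normrM normrM normrV ?unitfE// (gtr0_norm p_gt0) ltr_pdivrMr//.
apply: (@le_lt_trans _ _ (`|y| `^ (alpha + 1))).
  by rewrite norm_powR// normr_id ler_piMl ?powR_ge0// normr_sg; case: (y != 0).
(* This exhibits the radius of the neighbourhood of 0, namely
   [(e (alpha + 1))^(1 / (alpha + 1))]. *)
have -> : e * (alpha + 1) = ((e * (alpha + 1)) `^ (alpha + 1)^-1) `^ (alpha + 1).
  by rewrite -powRrM mulVf// powRr1// mulr_ge0 ?ltW.
apply: (gt0_ltr_powR p_gt0); rewrite ?nnegrE ?powR_ge0//.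
near: y; apply: (@cvgr0_norm_lt _ R _ _ _ id) => //.
by rewrite powR_gt0 ?mulr_gt0.
Unshelve. all: by end_near. Qed.

Lemma continuous_pprim_linear m : continuous (fun x => pprim x - m * x).
Proof.
move=> x; apply: cvgB; first exact: continuous_pprim.
by apply: cvgM; [exact: cvg_cst|exact: cvg_id].
Qed.

Lemma is_derive_pprim_linear m x : x != 0 ->
  is_derive x 1 (fun x => pprim x - m * x) (falpha alpha x - m).
Proof.
move=> x0; have d := is_derive_pprim x0.
have -> : (fun x => pprim x - m * x) = pprim - m \*: (id : R -> R) by [].
by apply: is_derive_eq; rewrite scaler1.
Qed.

Lemma integral_falpha a b : a <= b ->
  (\int[@lebesgue_measure R]_(x in `[a, b]) (falpha alpha x)%:E =
   (pprim b - pprim a)%:E)%E.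
Proof.
move=> ab; apply: integral_primitive => //.
- exact: continuous_pprim.
- exact: measurable_falpha.
- by move=> x; rewrite powR_ge0.
- by move=> x _; exact: continuous_falpha.
- by move=> x _; exact: is_derive_pprim.
Qed.

Lemma mean_falpha a b : a < b ->
  mean (falpha alpha) a b = (pprim b - pprim a) / (b - a).
Proof. by move=> ab; rewrite /mean integral_falpha ?ltW. Qed.

End PowerPrimitive.

(** * Monotonicity and convexity of powers, uniformly in the sign of [alpha] *)

Section PowerInequalities.
Set Implicit Arguments. Unset Strict Implicit.
Variables (R : realType) (alpha : R).
Implicit Types (s t x y : R).

(** The factor [Num.sg alpha] makes [x^alpha] nondecreasing, and [x^(alpha + 1)] convex, for either
    sign of [alpha]; later arguments then need few case splits. *)
Lemma sg_powR_le x y : 0 < x -> x <= y ->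
  Num.sg alpha * x `^ alpha <= Num.sg alpha * y `^ alpha.
Proof.
move=> x0 xy; have y0 : 0 < y by exact: lt_le_trans xy.
have [a0|a0|->] := ltgtP alpha 0; last by rewrite sgr0 !mul0r.
- rewrite ltr0_sg// !mulN1r lerN2 -(opprK alpha) (powRN x) (powRN y) lef_pV2 ?posrE ?powR_gt0//.
  by apply: ge0_ler_powR xy; rewrite ?oppr_ge0 ?nnegrE ltW.
- by rewrite gtr0_sg// !mul1r; apply: ge0_ler_powR xy; rewrite ?nnegrE ltW.
Qed.

Hypothesis alpha_gtN1 : -1 < alpha.

Let p_gt0 : 0 < alpha + 1. Proof. by rewrite -ltrBlDr sub0r. Qed.

(* Average 1 + y <= exp y over two multiples y of ln x, with the weights that
   cancel the logarithm. *)
Lemma sg_powR_bernoulli x : 0 < x ->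
  Num.sg alpha * (1 + (alpha + 1) * (x - 1)) <= Num.sg alpha * x `^ (alpha + 1).
Proof.
move=> x0; pose v := ln x.
have E q : x `^ q = expR (q * v) by rewrite /powR gt_eqF.
have xE : x = expR v by rewrite lnK.
rewrite E xE.
have [a0|a0|->] := ltgtP alpha 0; last by rewrite sgr0 !mul0r.
- rewrite ltr0_sg// !mulN1r lerN2.
  set e := expR ((alpha + 1) * v).
  have e0 : 0 < e by exact: expR_gt0.
  have h1 : e * (1 + (- alpha * v)) <= expR v.
    have -> : expR v = e * expR (- alpha * v) by rewrite -expRD; congr expR; ring.
    by rewrite ler_pM2l// expR_ge1Dx.
  have h2 : e * (1 + (- (alpha + 1) * v)) <= 1.
    rewrite [leRHS](_ : 1 = e * expR (- (alpha + 1) * v)).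
      by rewrite ler_pM2l// expR_ge1Dx.
    by rewrite -expRD -[LHS]expR0; congr expR; ring.
  have h3 := ler_wpM2l (ltW p_gt0) h1.
  have na : 0 <= - alpha by rewrite oppr_ge0 ltW.
  have h4 := ler_wpM2l na h2.
  lra.
- rewrite gtr0_sg// !mul1r.
  set e := expR v.
  have e0 : 0 < e by exact: expR_gt0.
  have h1 : e * (1 + alpha * v) <= expR ((alpha + 1) * v).
    have -> : expR ((alpha + 1) * v) = e * expR (alpha * v) by rewrite -expRD; congr expR; ring.
    by rewrite ler_pM2l// expR_ge1Dx.
  have h2 : e * (1 - v) <= 1.
    rewrite [leRHS](_ : 1 = e * expR (- v)); first by rewrite ler_pM2l// expR_ge1Dx.
    by rewrite -expRD -[LHS]expR0; congr expR; ring.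
  have h4 := ler_wpM2l (ltW a0) h2.
  lra.
Qed.

(** A convex function lies above its tangent at [y]; dividing by [y^(alpha + 1)] leaves the
    Bernoulli inequality at [x / y]. *)
Lemma sg_powR_tangent x y : 0 <= x -> 0 < y ->
  Num.sg alpha * (y `^ (alpha + 1) + (alpha + 1) * y `^ alpha * (x - y)) <=
  Num.sg alpha * x `^ (alpha + 1).
Proof.
move=> x0 y0.
have yE : y * y `^ alpha = y `^ (alpha + 1).
  by rewrite -[in LHS](addrK 1 alpha) mulr_powRB1// ltW.
have yp := powR_gt0 (alpha + 1) y0.
have -> : y `^ (alpha + 1) + (alpha + 1) * y `^ alpha * (x - y) =
    y `^ (alpha + 1) * (1 + (alpha + 1) * (x / y - 1)).
  rewrite -yE; field; exact: lt0r_neq0.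
(* At [x = 0], outside the Bernoulli inequality, the claim is [- |alpha| <= 0] up to a positive
   factor. *)
move: x0; rewrite le_eqVlt => /predU1P[<-|x0].
  rewrite powR0 ?gt_eqF// mulr0 mul0r sub0r mulrCA pmulr_rle0//.
  rewrite (_ : 1 + _ = - alpha); last by ring.
  by rewrite mulrN oppr_le0 -normrEsg.
have -> : x `^ (alpha + 1) = y `^ (alpha + 1) * (x / y) `^ (alpha + 1).
  rewrite -powRM ?ltW ?divr_gt0//; congr powR; field; exact: lt0r_neq0.
rewrite mulrCA [leRHS]mulrCA ler_pM2l//.
by apply: sg_powR_bernoulli; rewrite divr_gt0.
Qed.

(* Karamata: the pair (s + t - s t, s t) majorizes (s, t). *)
Lemma sg_powR_karamata s t : 0 <= s <= 1 -> 0 <= t <= 1 ->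
  Num.sg alpha * (s `^ (alpha + 1) + t `^ (alpha + 1)) <=
  Num.sg alpha * ((s + t - s * t) `^ (alpha + 1) + (s * t) `^ (alpha + 1)).
Proof.
wlog ts : s t / t <= s => [W hs ht|].
  have [|/ltW] := leP t s => h; first exact: W.
  by rewrite (addrC s) (mulrC s) (addrC (s `^ _)); apply: W.
move=> /andP[s0 s1] /andP[]; rewrite le_eqVlt => /predU1P[<- _|t0 t1].
  by rewrite mulr0 subr0 addr0.
have {}s0 : 0 < s by exact: lt_le_trans ts.
have st : s * t <= t by rewrite ler_piMl// ltW.
(* The tangents are taken at [s] and [t]. The increments [t - s t] and [s t - t] are opposite, so
   only the difference of the slopes remains, and it has the right sign because [t <= s]. *)
have h1 := @sg_powR_tangent (s + t - s * t) s _ s0.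
have h2 := @sg_powR_tangent (s * t) t _ t0.
have h3 := sg_powR_le t0 ts.
have h4 : 0 <= (alpha + 1) * (t - s * t) by rewrite mulr_ge0 ?subr_ge0// ltW.
have h5 := ler_wpM2l h4 h3.
have {}h2 := h2 (mulr_ge0 (ltW s0) (ltW t0)).

have u0 : 0 <= s + t - s * t by lra.
have {}h1 := h1 u0.
set A := s `^ alpha in h1 h5; set B := t `^ alpha in h2 h5.
set C := s `^ _ in h1 *; set D := t `^ _ in h2 *.
set U := _ `^ _ in h1 *; set V := _ `^ _ in h2 *.
move: h1 h2 h5; set z := Num.sg alpha => h1 h2 h5.
have -> : z * (C + D) = z * (C + (alpha + 1) * A * (s + t - s * t - s))
   + z * (D + (alpha + 1) * B * (s * t - t))
   - ((alpha + 1) * (t - s * t) * (z * A) - (alpha + 1) * (t - s * t) * (z * B)) by ring.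
rewrite mulrDr; lra.
Qed.

End PowerInequalities.

(** * Closed form of the relative oscillation, dilations and reflection *)

Section LevelSplit.
Set Implicit Arguments. Unset Strict Implicit.
Variables (R : realType) (alpha : R).
Hypotheses (alpha_gtN1 : -1 < alpha) (alpha_neq0 : alpha != 0).
Implicit Types (a b c d k r x : R).

Local Notation G := (pprim alpha).

(* Since G is a primitive, the equation says that |x|^alpha has mean r^alpha. *)
Definition level_split a b r c d : Prop :=
  [/\ a < b, [/\ a <= c, c <= d & d <= b], 0 < r,
      G b - G a = r `^ alpha * (b - a) &
      (forall x, c < x < d -> `|x| <= r) /\
      (forall x, a < x < c \/ d < x < b -> r <= `|x|)].

(** [z] is the constant sign of [|x|^alpha - m] on the interval, so [z (G x - m x)] is a primitive
    of the absolute value. *)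
Lemma integral_dist_falpha a b m z : a <= b -> `|z| = 1 ->
  (forall x, a < x < b -> x != 0 -> 0 <= z * (falpha alpha x - m)) ->
  (\int[@lebesgue_measure R]_(x in `[a, b]) `|falpha alpha x - m|%:E =
   (z * (G b - m * b - (G a - m * a)))%:E)%E.
Proof.
move=> ab z1 zf; rewrite mulrBr.
have cH := @continuous_pprim_linear R alpha alpha_gtN1 m.
have zfE x : a < x < b -> x != 0 -> z * (falpha alpha x - m) = `|falpha alpha x - m|.
  by move=> xab x0; rewrite -[LHS]ger0_norm ?zf// normrM z1 mul1r.
apply: (@integral_primitive _ (fun x => z * (G x - m * x)) (fun x => `|falpha alpha x - m|)) => //.
- by move=> x; apply: cvgM; [exact: cvg_cst|exact: cH].
- apply: measurableT_comp; first exact: normr_measurable.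
  by apply: measurable_funB; [exact: measurable_falpha|exact: measurable_cst].
- move=> x _ x0; apply: cvg_norm; apply: cvgB; last exact: cvg_cst.
  exact: continuous_falpha.
- move=> x xab x0; have d := is_derive_pprim_linear alpha_gtN1 m x0.
  rewrite -zfE//.
  exact: (@is_deriveZ _ _ _ _ z).
Qed.

(** Deviations from the mean integrate to zero, so the two outer intervals contribute together
    exactly as much as [[c, d]]; hence the factor 2. *)
Lemma relosc_level_split a b r c d : level_split a b r c d ->
  relosc (falpha alpha) a b =
  2 * Num.sg alpha * (G c - r `^ alpha * c - (G d - r `^ alpha * d)) / (G b - G a).
Proof.
move=> [ab [ac cd db] r0 mE [lo hi]].
rewrite /relosc /Omega mean_falpha// mE mulfK ?subr_eq0 ?gt_eqF//.
set m := r `^ alpha in mE *; set z := Num.sg alpha.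
have z1 : `|z| = 1 by rewrite normr_sg alpha_neq0.
have I u v : u <= v -> (forall x, u < x < v -> r <= `|x|) ->
   (\int[@lebesgue_measure R]_(x in `[u, v]) `|falpha alpha x - m|%:E =
   (z * (G v - m * v - (G u - m * u)))%:E)%E.
  move=> uv H; apply: integral_dist_falpha => // x xuv x0.
  by rewrite mulrBr subr_ge0; apply: sg_powR_le => //; exact: H.
have J : (\int[@lebesgue_measure R]_(x in `[c, d]) `|falpha alpha x - m|%:E =
   (- z * (G d - m * d - (G c - m * c)))%:E)%E.
  apply: integral_dist_falpha => //; first by rewrite normrN.
  move=> x xcd x0; rewrite mulNr oppr_ge0 mulrBr subr_le0.
  by apply: sg_powR_le; [rewrite normr_gt0|exact: lo].
have mf : measurable_fun setT (fun x => `|falpha alpha x - m|).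
  apply: measurableT_comp; first exact: normr_measurable.
  by apply: measurable_funB; [exact: measurable_falpha|exact: measurable_cst].
rewrite /mean (@integral_itv_cat _ _ a c b)//; last exact: le_trans db.
rewrite (@integral_itv_cat _ _ c d b)// J !I//.
- rewrite -!EFinD [fine _]/=.
  rewrite [in LHS](_ : z * _ + _ = 2 * z * (G c - m * c - (G d - m * d))).
    field.
    by rewrite subr_eq0 (gt_eqF ab)/= gt_eqF// powR_gt0.
  move: mE => /eqP; rewrite subr_eq => /eqP ->; ring.
- by move=> x xdb; apply: hi; right.
- by move=> x xac; apply: hi; left.
Qed.

Lemma level_splitZ k a b r c d : 0 < k -> level_split a b r c d ->
  level_split (k * a) (k * b) (k * r) (k * c) (k * d).
Proof.
move=> k0 [ab [ac cd db] r0 mE [lo hi]].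
have itvZ u v x : (k * u < x < k * v) = (u < x / k < v).
  by rewrite ltr_pdivlMr// ltr_pdivrMr// !(mulrC _ k).
have normZ x : `|x| = k * `|x / k|.
  by rewrite normrM normfV (gtr0_norm k0); field; rewrite gt_eqF.
split; first by rewrite ltr_pM2l.
- by rewrite !ler_pM2l.
- exact: mulr_gt0.
- rewrite !pprimZ// -mulrBr mE powRM ?ltW// -mulr_powRB1 ?ltW//; last first.
    by rewrite -ltrBlDr sub0r.
  by rewrite addrK; ring.
- split=> x.
    by rewrite itvZ => /lo; rewrite (normZ x) ler_pM2l.
  by rewrite !itvZ => /hi; rewrite (normZ x) ler_pM2l.
Qed.

Lemma level_splitN a b r c d : level_split a b r c d ->
  level_split (- b) (- a) r (- d) (- c).
Proof.
move=> [ab [ac cd db] r0 mE [lo hi]].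
have itvN u v x : (- v < x < - u) = (u < - x < v) by rewrite ltrNl ltrNr andbC.
split=> //; first by rewrite ltrN2.
- by rewrite !lerN2.
- by rewrite !pprimN opprK addrC mE addrC opprK.
- split=> x; first by rewrite itvN -[`|x|]normrN => /lo.
  by rewrite !itvN -[`|x|]normrN => -[] h; apply: hi; [right|left].
Qed.

(** In the closed form, numerator and denominator both acquire the factor [k^(alpha + 1)]. *)
Lemma reloscZ k a b r c d : 0 < k -> level_split a b r c d ->
  relosc (falpha alpha) (k * a) (k * b) = relosc (falpha alpha) a b.
Proof.
move=> k0 s; rewrite (relosc_level_split s) (relosc_level_split (level_splitZ k0 s)).
case: s => ab _ r0 mE _.
have ba : b - a != 0 by rewrite subr_eq0 gt_eqF.
have [ka ra] : k `^ alpha != 0 /\ r `^ alpha != 0 by split; rewrite gt_eqF// powR_gt0.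
rewrite !pprimZ// powRM ?ltW// -mulr_powRB1 ?ltW//; last by rewrite -ltrBlDr sub0r.
rewrite addrK -mulrBr mE; field.
by rewrite ba ra ka gt_eqF.
Qed.

Lemma reloscN a b r c d : level_split a b r c d ->
  relosc (falpha alpha) (- b) (- a) = relosc (falpha alpha) a b.
Proof.
move=> s; rewrite (relosc_level_split s) (relosc_level_split (level_splitN s)).
by rewrite !pprimN; congr (_ * _ / _); ring.
Qed.

(** The mean value theorem for [pprim] supplies [r]; it needs no derivative at the endpoint [a],
    which may be 0. *)
Lemma level_split_ge0 a b : 0 <= a -> a < b ->
  exists2 r, a < r < b & level_split a b r a r.
Proof.
move=> a0 ab.
have [| |r] := @MVT _ G (falpha alpha) a b ab.
- move=> x; rewrite in_itv/= => /andP[ax _]; apply: is_derive_pprim => //.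
  by rewrite gt_eqF// (le_lt_trans a0).
- by apply: continuous_subspaceT; exact: continuous_pprim.
rewrite in_itv/= => /andP[ar rb] mE.
have r0 : 0 < r by exact: le_lt_trans ar.
exists r; rewrite ?ar//; split=> //.
- by split; rewrite // ltW.
- by rewrite mE /falpha gtr0_norm.
- split=> x.
    by move=> /andP[ax xr]; rewrite ger0_norm ltW// (le_lt_trans a0).
  move=> [/andP[/lt_trans h /h]|/andP[rx _]]; first by rewrite ltxx.
  by rewrite ger0_norm ltW// (lt_trans r0).
Qed.

End LevelSplit.

(** * Relative oscillation on [[t, 1]] and on [[-eta, 1]] *)

Section RelativeOscillation.
Set Implicit Arguments. Unset Strict Implicit.
Variables (R : realType) (alpha : R).
Hypotheses (alpha_gtN1 : -1 < alpha) (alpha_neq0 : alpha != 0).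
Implicit Types (a b c d k r x eta : R).

Let p_gt0 : 0 < alpha + 1. Proof. by rewrite -ltrBlDr sub0r. Qed.
Let p_neq0 : alpha + 1 != 0. Proof. by rewrite gt_eqF. Qed.

Lemma sg_powR_lt x y : 0 < x -> x < y ->
  Num.sg alpha * x `^ alpha < Num.sg alpha * y `^ alpha.
Proof.
move=> x0 xy; have y0 := lt_trans x0 xy.
rewrite lt_neqAle sg_powR_le ?(ltW xy)// andbT.
have sg0 : Num.sg alpha != 0 by rewrite sgr_eq0.
apply: contraTneq xy => /(mulfI sg0)/(congr1 (fun u => u `^ alpha^-1)).
by rewrite -!powRrM divff// !powRr1 ?ltW// => ->; rewrite ltxx.
Qed.

(** Since [Num.sg alpha * alpha = |alpha|], this is the known value of the norm on the half-line. *)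
Definition GRplus_const : R :=
  2 * Num.sg alpha * alpha / (alpha + 1) `^ ((alpha + 1) / alpha).

Lemma GRplus_const_gt0 : 0 < GRplus_const.
Proof.
rewrite /GRplus_const divr_gt0 ?powR_gt0// -mulrA -normrEsg mulr_gt0//.
by rewrite normr_gt0.
Qed.

Lemma powR_div_alpha x : 0 < x -> x `^ ((alpha + 1) / alpha) = x * x `^ (1 / alpha).
Proof.
move=> x0; rewrite mulrDl divff// powRD; last by rewrite (gt_eqF x0) implybT.
by rewrite powRr1// ltW.
Qed.

Lemma powRV x q : 0 <= x -> x^-1 `^ q = (x `^ q)^-1.
Proof. by move=> x0; rewrite -powR_inv1// powRAC powR_inv1// powR_ge0. Qed.

Lemma relosc_unit_le t : 0 <= t < 1 -> relosc (falpha alpha) t 1 <= GRplus_const.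
Proof.
move=> /andP[t0 t1].
have [r /andP[tr r1] sp] := level_split_ge0 alpha_gtN1 t0 t1.
rewrite (relosc_level_split alpha_gtN1 alpha_neq0 sp).
case: sp => _ _ r0 mE _.
have tp : t `^ (alpha + 1) < 1.
  rewrite [ltRHS](_ : 1 = 1 `^ (alpha + 1)); last by rewrite powR1.
  by apply: gt0_ltr_powR t1; rewrite ?nnegrE.
move: mE; rewrite !pprimE ?ler01// ?(ltW r0)// powR1/=.
set T := t `^ (alpha + 1) in tp *; set Q := r `^ (alpha + 1).
set z := Num.sg alpha => mE.
(* [s] is the fraction of the length of [[t, 1]] below [r], so [r = s + t - s t] is the larger entry
   of the majorizing pair. *)
pose s := (r - t) / (1 - t).
have t10 : 1 - t != 0 by rewrite subr_eq0 gt_eqF.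
have T10 : 1 - T != 0 by rewrite subr_eq0 gt_eqF.
have s0 : 0 <= s by rewrite divr_ge0// subr_ge0 ltW.
have s1 : s <= 1 by rewrite ler_pdivrMr ?subr_gt0// mul1r lerD2r ltW.
have := @sg_powR_karamata _ _ alpha_gtN1 s t.
rewrite s0 s1 t0 (ltW t1) => /(_ isT isT).
rewrite powRM// -/T (_ : s + t - s * t = r); last by rewrite /s; field.
rewrite -/Q -/z; set S := s `^ _ => K.
(* [u] is the critical point of [s - s^(alpha + 1)], given by [(alpha + 1) u^alpha = 1]; the tangent
   at [u] bounds that function by its value there. *)
pose u := (alpha + 1) `^ (- (1 / alpha)).
have u0 : 0 < u by rewrite powR_gt0.
have ua : u `^ alpha = (alpha + 1)^-1.
  by rewrite -powRrM mulNr div1r mulVf// powR_inv1// ltW.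
have up : u `^ (alpha + 1) = u / (alpha + 1).
  by rewrite -mulr_powRB1 ?ltW// addrK ua.
have := sg_powR_tangent alpha_gtN1 s0 u0.
rewrite ua up -/z -/S => L.
have cE : GRplus_const = 2 * z * (u - u / (alpha + 1)).
  rewrite /GRplus_const powR_div_alpha// /u powRN -/z; field.
  by rewrite p_neq0 gt_eqF// powR_gt0.
have -> : r `^ alpha = ((1 - T) / (alpha + 1)) / (1 - t).
  by rewrite mulrBl mE; field.
(* The closed form becomes the fraction of length minus the fraction of integral carried by
   [[t, r]], times [2 z]. *)
have -> : 2 * z * (T / (alpha + 1) - (1 - T) / (alpha + 1) / (1 - t) * t -
     (Q / (alpha + 1) - (1 - T) / (alpha + 1) / (1 - t) * r)) /
     (1 / (alpha + 1) - T / (alpha + 1)) = 2 * z * s - 2 * (z * (Q - T) / (1 - T)).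
  by rewrite /s; field; rewrite t10 T10 p_neq0.
(* Here [(s t)^(alpha + 1) = S T], so the majorization inequality [K] factors through [1 - T]. *)
have K' : z * S <= z * (Q - T) / (1 - T).
  by rewrite ler_pdivlMr ?subr_gt0//; lra.
rewrite cE.
have e : z * (u / (alpha + 1) + (alpha + 1) / (alpha + 1) * (s - u)) =
    z * (u / (alpha + 1) + s - u).
  by rewrite divff// mul1r addrA.
by rewrite e in L; lra.
Qed.

(* The positive point at which |x|^alpha equals its mean over [-eta, 1]. *)
Definition eqmean_pt eta : R :=
  ((1 + eta `^ (alpha + 1)) / ((alpha + 1) * (1 + eta))) `^ (1 / alpha).

Definition psi_ratio eta : R :=
  (1 + eta `^ (alpha + 1)) `^ (1 / alpha) / (1 + eta) `^ ((alpha + 1) / alpha).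

Definition psi_small eta : R :=
  psi_ratio eta + (alpha + 1) `^ ((alpha + 1) / alpha) / alpha
    * ((1 + eta `^ (alpha + 1))^-1 - (1 + eta)^-1).

Lemma psiE eta1 eta : psi alpha eta1 eta =
  if eta <= eta1 then psi_small eta else 2 * psi_ratio eta.
Proof. by []. Qed.

Section UnitInterval.
Variable eta : R.
Hypothesis eta01 : 0 <= eta <= 1.

Let eta_ge0 : 0 <= eta. Proof. by case/andP: eta01. Qed.
Let eta_le1 : eta <= 1. Proof. by case/andP: eta01. Qed.
Let eta1_gt0 : 0 < 1 + eta. Proof. by rewrite ltr_wpDr. Qed.
Let E_gt0 : 0 < 1 + eta `^ (alpha + 1). Proof. by rewrite ltr_wpDr// powR_ge0. Qed.
Let m_gt0 : 0 < (1 + eta `^ (alpha + 1)) / ((alpha + 1) * (1 + eta)).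
Proof. by rewrite divr_gt0// mulr_gt0. Qed.

Lemma eqmean_pt_gt0 : 0 < eqmean_pt eta. Proof. exact: powR_gt0. Qed.

Lemma powR_eqmean_pt : eqmean_pt eta `^ alpha =
  (1 + eta `^ (alpha + 1)) / ((alpha + 1) * (1 + eta)).
Proof. by rewrite -powRrM div1r mulVf// powRr1// ltW. Qed.

(** This is how [psi_ratio] enters: the closed form is affine in the level point. *)
Lemma eqmean_ptE : eqmean_pt eta =
  (alpha + 1) * (1 + eta) * psi_ratio eta / (alpha + 1) `^ ((alpha + 1) / alpha).
Proof.
rewrite /eqmean_pt /psi_ratio powRM ?ltW ?invr_gt0 ?mulr_gt0//.
rewrite powRV ?ltW ?mulr_gt0// powRM ?ltW// !powR_div_alpha//; field.
by rewrite p_neq0 !gt_eqF ?powR_gt0.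
Qed.

(** By monotonicity the mean is compared with 1, which reduces to comparing [eta^(alpha + 1)] with
    [eta] on [[0, 1]], in a direction set by the sign of [alpha]. *)
Lemma eqmean_pt_le1 : eqmean_pt eta <= 1.
Proof.
rewrite leNgt; apply/negP => /(sg_powR_lt ltr01).
rewrite powR_eqmean_pt powR1 /= => /lt_geF/negP; apply.
rewrite mulrA ler_pdivrMr ?mulr_gt0//.
have etaE : 0 < eta \/ eta = 0.
  by move: eta_ge0; rewrite le_eqVlt => /predU1P[->|]; [right|left].
have [a0|a0|a0] := ltgtP alpha 0; last by move: alpha_neq0; rewrite a0 eqxx.
- rewrite ltr0_sg//.
  have h : eta <= eta `^ (alpha + 1).
    case: etaE => [e0|->]; last by rewrite powR0.
    by apply: ger1_powR; rewrite ?e0//; lra.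
  have : 0 <= - alpha * (1 + eta) by rewrite mulr_ge0 ?oppr_ge0 ?ltW.
  lra.
- rewrite gtr0_sg//.
  have h : eta `^ (alpha + 1) <= eta.
    case: etaE => [e0|->]; last by rewrite powR0.
    by apply: ge1r_powR; rewrite ?e0//; lra.
  have : 0 <= alpha * (1 + eta) by rewrite mulr_ge0 ?ltW.
  lra.
Qed.

Let primB : pprim alpha 1 - pprim alpha (- eta) =
  eqmean_pt eta `^ alpha * (1 - - eta).
Proof.
rewrite powR_eqmean_pt pprimN !pprimE// powR1/= !opprK; field.
by rewrite p_neq0 gt_eqF.
Qed.

Let ltN1 : - eta < 1. Proof. by rewrite (le_lt_trans _ (@ltr01 R))// oppr_le0. Qed.

Let powR_eqmean_pt1 : eqmean_pt eta `^ (alpha + 1) =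
  eqmean_pt eta * ((1 + eta `^ (alpha + 1)) / ((alpha + 1) * (1 + eta))).
Proof.
by rewrite -powR_eqmean_pt -mulr_powRB1 ?addrK// ltW// eqmean_pt_gt0.
Qed.

(** All of [[-eta, 0]] lies within the level radius, so the left outer interval is degenerate. *)
Lemma level_split_small : eta <= eqmean_pt eta ->
  level_split alpha (- eta) 1 (eqmean_pt eta) (- eta) (eqmean_pt eta).
Proof.
have x0 := eqmean_pt_gt0 => le; split=> //.
  by split; rewrite ?eqmean_pt_le1// (le_trans _ (ltW x0))// oppr_le0.
split=> x.
  move=> /andP[h1 h2]; rewrite ler_norml (ltW h2) andbT (le_trans _ (ltW h1))//.
  by rewrite lerN2.
move=> [/andP[/lt_trans h /h]|/andP[h _]]; first by rewrite ltxx.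
by rewrite (le_trans (ltW h))// ler_norm.
Qed.

Lemma relosc_small : eta <= eqmean_pt eta ->
  relosc (falpha alpha) (- eta) 1 = GRplus_const * psi_small eta.
Proof.
move=> /level_split_small s.
rewrite (relosc_level_split alpha_gtN1 alpha_neq0 s).
rewrite pprimN !pprimE ?powR1/= ?(ltW eqmean_pt_gt0)// powR_eqmean_pt1 powR_eqmean_pt.
rewrite eqmean_ptE /GRplus_const /psi_small.
set P := _ `^ (_ / alpha); field.
by rewrite p_neq0 alpha_neq0 !gt_eqF// powR_gt0.
Qed.

(** Both level points now lie in [[-eta, 1]], and the inner interval is symmetric. *)
Lemma level_split_large : eqmean_pt eta <= eta ->
  level_split alpha (- eta) 1 (eqmean_pt eta) (- eqmean_pt eta) (eqmean_pt eta).
Proof.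
have x0 := eqmean_pt_gt0 => le; split=> //.
  by split; rewrite ?eqmean_pt_le1 ?lerN2// (le_trans _ (ltW x0))// oppr_le0 ltW.
split=> x; first by move=> /andP[h1 h2]; rewrite ler_norml !ltW.
move=> [/andP[_ h]|/andP[h _]].
  by rewrite -normrN (le_trans _ (ler_norm _))// lerNr ltW.
by rewrite (le_trans (ltW h))// ler_norm.
Qed.

Lemma relosc_large : eqmean_pt eta <= eta ->
  relosc (falpha alpha) (- eta) 1 = GRplus_const * (2 * psi_ratio eta).
Proof.
move=> /level_split_large s.
rewrite (relosc_level_split alpha_gtN1 alpha_neq0 s).
rewrite !pprimN !pprimE ?powR1/= ?(ltW eqmean_pt_gt0)// powR_eqmean_pt1 powR_eqmean_pt.
rewrite eqmean_ptE /GRplus_const.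
set P := _ `^ (_ / alpha); field.
by rewrite opprK p_neq0 !gt_eqF// powR_gt0.
Qed.

End UnitInterval.

End RelativeOscillation.

(** * The threshold [eta1] and the branches of [psi] *)

Section Threshold.
Set Implicit Arguments. Unset Strict Implicit.
Variables (R : realType) (alpha : R).
Hypotheses (alpha_gtN1 : -1 < alpha) (alpha_neq0 : alpha != 0).
Implicit Types (a b c d k r x q eta : R).

Let p_gt0 : 0 < alpha + 1. Proof. by rewrite -ltrBlDr sub0r. Qed.
Let p_neq0 : alpha + 1 != 0. Proof. by rewrite gt_eqF. Qed.

(** Intermediate values on [[0, 1]]: for [alpha < 0] of [x^|alpha| - (1 + alpha (x + 1))], from
    [-(1 + alpha)] to [-2 alpha]; for [alpha > 0] of [x^alpha (1 + alpha (x + 1))], from 0 to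
    [1 + 2 alpha], across 1. *)
Lemma eta1_exists : exists eta1, 0 < eta1 < 1 /\ eta1_eq alpha eta1.
Proof.
have p0 := p_gt0.
pose q : R := `|alpha|; have q0 : 0 < q by rewrite normr_gt0.
have qN1 : -1 < q - 1 by rewrite ltrBrDr addNr.
(* u is x^|alpha| on [0, +oo[, extended to a function continuous at 0. *)
pose u x : R := q * pprim (q - 1) x.
have cu : continuous u by move=> x; apply: cvgM; [exact: cvg_cst|exact: continuous_pprim].
have uE x : 0 <= x -> u x = x `^ q.
  by move=> x0; rewrite /u pprimE// subrK mulrCA divff ?mulr1// gt_eqF.
have u1 : u 1 = 1 by rewrite uE// powR1.
have u0 : u 0 = 0 by rewrite /u pprim0 mulr0.
have clin : continuous (fun x : R => 1 + alpha * (x + 1)).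
  move=> x; apply: cvgD; first exact: cvg_cst.
  by apply: cvgM; [exact: cvg_cst|apply: cvgD; [exact: cvg_id|exact: cvg_cst]].
have [a0|a0|a0] := ltgtP alpha 0; last by move: alpha_neq0; rewrite a0 eqxx.
- have [||x] := @IVT R (fun x => u x - (1 + alpha * (x + 1))) 0 1 0 ler01.
  + by apply: continuous_subspaceT => x; apply: cvgB; [exact: cu|exact: clin].
  + rewrite /= u0 u1 ge_min le_max; apply/andP; split; apply/orP.
      by left; lra.
    by right; lra.
  rewrite in_itv/= => /andP[x0 x1] /eqP; rewrite subr_eq0 => /eqP xE.
  have {}x0 : 0 < x.
    rewrite lt_neqAle x0 andbT; apply/eqP => x00.
    by move: xE; rewrite -x00 u0; lra.
  have {}x1 : x < 1.
    rewrite lt_neqAle x1 andbT; apply/eqP => x10.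
    by move: xE; rewrite x10 u1; lra.
  exists x; rewrite x0 x1; split=> //.
  by rewrite /eta1_eq -xE uE ?ltW// /q ltr0_norm// powRN invrK.
- have [||x] := @IVT R (fun x => u x * (1 + alpha * (x + 1))) 0 1 1 ler01.
  + by apply: continuous_subspaceT => x; apply: cvgM; [exact: cu|exact: clin].
  + by rewrite /= u0 u1 ge_min le_max mul0r ler01/= mul1r lerDl mulr_ge0 ?orbT// ltW.
  rewrite in_itv/= => /andP[x0 x1] xE.
  have {}x0 : 0 < x.
    rewrite lt_neqAle x0 andbT; apply/eqP => x00.
    by move: xE; rewrite -x00 u0; lra.
  have {}x1 : x < 1.
    rewrite lt_neqAle x1 andbT; apply/eqP => x10.
    by move: xE; rewrite x10 u1; lra.
  exists x; rewrite x0 x1; split=> //.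
  rewrite /eta1_eq -[in LHS](gtr0_norm a0) -/q -uE ?ltW//.
  rewrite -[RHS]mul1r; apply: (canRL (mulfK _)); last by rewrite xE.
  by apply: contra_eq_neq xE => ->; rewrite mulr0 eq_sym oner_eq0.
Qed.

Variable eta1 : R.
Hypotheses (eta1_01 : 0 < eta1 < 1) (eta1E : eta1_eq alpha eta1).

Let eta1_gt0 : 0 < eta1. Proof. by case/andP: eta1_01. Qed.
Let eta1_lt1 : eta1 < 1. Proof. by case/andP: eta1_01. Qed.

(* Writing eta1_eq as eta^(-alpha) = 1 + alpha (eta + 1) makes its two sides
   monotone in opposite directions whatever the sign of alpha. *)
Let gap eta := Num.sg alpha * (eta `^ (- alpha) - (1 + alpha * (eta + 1))).

Let gap_eta1 : gap eta1 = 0.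
Proof. by rewrite /gap powRN eta1E invrK subrr mulr0. Qed.

Let gap_le x y : 0 < x -> x <= y -> gap y <= gap x.
Proof.
move=> x0 xy; have := @sg_powR_le _ (- alpha) _ _ x0 xy.
rewrite sgrN !mulNr lerN2 /gap => h.
have : Num.sg alpha * alpha * x <= Num.sg alpha * alpha * y.
  by rewrite ler_wpM2l// -normrEsg.
lra.
Qed.

(** The other factors are positive, so the sign of [gap] decides the order of [eqmean_pt alpha eta]
    and [eta]. *)
Let gapE eta : 0 < eta -> eta <= 1 -> Num.sg alpha * (eqmean_pt alpha eta `^ alpha) -
  Num.sg alpha * eta `^ alpha = eta `^ alpha * gap eta / ((alpha + 1) * (1 + eta)).
Proof.
move=> eta0 eta_le1; rewrite powR_eqmean_pt//; last by rewrite ltW.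
have -> : eta `^ (alpha + 1) = eta * eta `^ alpha.
  by rewrite -mulr_powRB1 ?addrK// ltW.
rewrite /gap powRN; field.
by rewrite p_neq0 !gt_eqF ?powR_gt0// ltr_wpDr ?ltW.
Qed.

(** [gap] is nonincreasing and vanishes at [eta1], so it is nonnegative before it; [eta = 0] is
    treated apart. *)
Lemma le_eqmean_pt eta : 0 <= eta -> eta <= eta1 -> eta <= eqmean_pt alpha eta.
Proof.
rewrite le_eqVlt => /predU1P[<- _|eta0 le1].
  by rewrite ltW// eqmean_pt_gt0// lexx ler01.
have e1 : eta <= 1 by rewrite (le_trans le1) ?ltW.
rewrite leNgt; apply/negP.
have x0 : 0 < eqmean_pt alpha eta.
  by rewrite eqmean_pt_gt0// ltW.
move=> /(sg_powR_lt alpha_neq0 x0); apply/negP; rewrite -leNgt -subr_ge0 gapE//.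
apply: divr_ge0; last by rewrite mulr_ge0 ?(ltW p_gt0)// addr_ge0 ?ltW.
by apply: mulr_ge0; [exact: powR_ge0|rewrite -gap_eta1 gap_le].
Qed.

Lemma eqmean_pt_le eta : eta1 <= eta -> eta <= 1 -> eqmean_pt alpha eta <= eta.
Proof.
move=> le1 e1; have eta0 : 0 < eta by exact: lt_le_trans le1.
rewrite leNgt; apply/negP.
move=> /(sg_powR_lt alpha_neq0 eta0); apply/negP; rewrite -leNgt -subr_le0 gapE//.
apply: mulr_le0_ge0; last by rewrite invr_ge0 mulr_ge0 ?(ltW p_gt0)// addr_ge0 ?ltW.
by apply: mulr_ge0_le0; [exact: powR_ge0|rewrite -gap_eta1 gap_le].
Qed.

Lemma relosc_psi eta : 0 <= eta <= 1 ->
  relosc (falpha alpha) (- eta) 1 = GRplus_const alpha * psi alpha eta1 eta.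
Proof.
move=> h; have /andP[eta0 e1] := h; rewrite psiE; case: leP => [|/ltW] le1.
  by rewrite relosc_small// le_eqmean_pt.
by rewrite relosc_large// eqmean_pt_le.
Qed.

(** Provides the split that the dilation and reflection lemmas take as hypothesis. *)
Lemma level_split_unit eta : 0 <= eta <= 1 ->
  exists r c d, level_split alpha (- eta) 1 r c d.
Proof.
move=> h; have /andP[eta0 e1] := h; have [|/ltW] := leP eta eta1 => le1.
  by do 3 eexists; apply: level_split_small => //; exact: le_eqmean_pt.
by do 3 eexists; apply: level_split_large => //; exact: eqmean_pt_le.
Qed.

(** At [eta1] both orderings of [eta1] and its level point hold, so both formulas compute the same
    relative oscillation. *)
Lemma psi_eta1 : psi_small alpha eta1 = 2 * psi_ratio alpha eta1.
Proof.
have h : 0 <= eta1 <= 1 by rewrite !ltW.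
apply: (mulfI (lt0r_neq0 (GRplus_const_gt0 alpha_gtN1 alpha_neq0))).
rewrite -(relosc_small alpha_gtN1 alpha_neq0 h) ?le_eqmean_pt ?(ltW eta1_gt0)//.
by rewrite relosc_large// eqmean_pt_le// ltW.
Qed.

Lemma psi0 : psi alpha eta1 0 = 1.
Proof.
rewrite psiE ltW// /psi_small /psi_ratio powR0// !addr0 !powR1/=.
by rewrite subrr mulr0 addr0 divr1.
Qed.

End Threshold.

(** * Existence of the maximum of [psi] *)

Section PsiMax.
Set Implicit Arguments. Unset Strict Implicit.
Variables (R : realType) (alpha : R).
Hypotheses (alpha_gtN1 : -1 < alpha) (alpha_neq0 : alpha != 0).

Let cvg_powR (f : R -> R) q x : f y @[y --> x] --> f x -> 0 < f x ->
  f y `^ q @[y --> x] --> f x `^ q.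
Proof.
move=> cf f0; apply: (@continuous_comp _ _ _ f (fun y => y `^ q)) => //.
apply: differentiable_continuous; apply/derivable1_diffP.
by apply: derivable_powR; rewrite in_itv/= andbT.
Qed.

Let p_gt0 : 0 < alpha + 1. Proof. by rewrite -ltrBlDr sub0r. Qed.

(** Agrees with [x^(alpha + 1)] for [x >= 0] but is continuous from both sides at 0, as needed for
    the extreme value theorem. *)
Let powp x := (alpha + 1) * pprim alpha x.

Let powpE x : 0 <= x -> x `^ (alpha + 1) = powp x.
Proof. by move=> x0; rewrite /powp pprimE// mulrCA divff ?mulr1// gt_eqF. Qed.

Let cvg_1powp x : 1 + powp y @[y --> x] --> 1 + powp x.
Proof.
apply: cvgD; first exact: cvg_cst.
by apply: cvgM; [exact: cvg_cst|exact: continuous_pprim].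
Qed.

Let cvg_1D (x : R) : 1 + y @[y --> x] --> 1 + x.
Proof. by apply: cvgD; [exact: cvg_cst|exact: cvg_id]. Qed.

Let gt0_1powp x : 0 <= x -> 0 < 1 + powp x.
Proof. by move=> x0; rewrite -powpE// ltr_wpDr// powR_ge0. Qed.

Let ratio x := (1 + powp x) `^ (1 / alpha) / (1 + x) `^ ((alpha + 1) / alpha).

Let continuous_ratio x : 0 <= x -> {for x, continuous ratio}.
Proof.
move=> x0; have x1 : 0 < 1 + x by rewrite ltr_wpDr.
apply: cvgM.
  exact: (cvg_powR (@cvg_1powp x) (gt0_1powp x0)).
apply: cvgV; first by rewrite gt_eqF// powR_gt0.
exact: (cvg_powR (@cvg_1D x) x1).
Qed.

Lemma psi_ratio_max a b : 0 <= a -> a <= b ->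
  exists2 c, a <= c <= b & forall x, a <= x <= b -> psi_ratio alpha x <= psi_ratio alpha c.
Proof.
move=> a0 ab; have [|c] := @EVT_max R ratio a b ab.
  apply: continuous_in_subspaceT => x; rewrite inE/= in_itv/= => /andP[ax _].
  by apply: continuous_ratio; exact: le_trans ax.
rewrite in_itv/= => cab cmax; exists c => // x xab.
have /andP[/(le_trans a0) c0 _] := cab; have /andP[/(le_trans a0) x0 _] := xab.
by rewrite /psi_ratio !powpE//; apply: cmax; rewrite in_itv.
Qed.

Lemma psi_small_max a b : 0 <= a -> a <= b ->
  exists2 c, a <= c <= b & forall x, a <= x <= b -> psi_small alpha x <= psi_small alpha c.
Proof.
move=> a0 ab; set K := (alpha + 1) `^ ((alpha + 1) / alpha) / alpha.
have [|c] := @EVT_max R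
    (fun x => ratio x + K * ((1 + powp x)^-1 - (1 + x)^-1)) a b ab.
  apply: continuous_in_subspaceT => x; rewrite inE/= in_itv/= => /andP[ax _].
  have x0 := le_trans a0 ax.
  apply: cvgD; first exact: continuous_ratio.
  apply: cvgM; first exact: cvg_cst.
  apply: cvgB; apply: cvgV; [|exact: cvg_1powp| |exact: cvg_1D].
    by rewrite gt_eqF// gt0_1powp.
  by rewrite gt_eqF// ltr_wpDr.
rewrite in_itv/= => cab cmax; exists c => // x xab.
have /andP[/(le_trans a0) c0 _] := cab; have /andP[/(le_trans a0) x0 _] := xab.
by rewrite /psi_small /psi_ratio !powpE//; apply: cmax; rewrite in_itv.
Qed.

(** Each branch is maximized on its own closed interval and the larger value is kept. *)
Lemma psi_max eta1 : 0 < eta1 < 1 -> eta1_eq alpha eta1 ->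
  exists2 c, 0 <= c <= 1 &
    forall x, 0 <= x <= 1 -> psi alpha eta1 x <= psi alpha eta1 c.
Proof.
move=> e01 eE; have /andP[/ltW e0 /ltW e1] := e01.
have [c /andP[c0 c1] cmax] := psi_small_max (lexx 0) e0.
have [d /andP[d0 d1] dmax] := psi_ratio_max e0 e1.
have cE : psi alpha eta1 c = psi_small alpha c by rewrite psiE c1.
have dE : psi alpha eta1 d = 2 * psi_ratio alpha d.
  (* The maximizer [d] may be [eta1] itself, where [psi] uses its first branch. *)
  rewrite psiE; case: ifPn => // de.
  have -> : d = eta1 by apply/le_anti; rewrite de.
  exact: psi_eta1.
have H x : 0 <= x <= 1 ->
    psi alpha eta1 x <= psi alpha eta1 c \/ psi alpha eta1 x <= psi alpha eta1 d.
  move=> /andP[x0 x1]; rewrite (psiE alpha eta1 x) cE dE; case: (leP x eta1) => [|/ltW] xe.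
    by left; apply: cmax; rewrite x0.
  by right; rewrite ler_pM2l//; apply: dmax; rewrite xe.
have [cd|/ltW dc] := leP (psi alpha eta1 c) (psi alpha eta1 d).
  exists d; first by rewrite d1 (le_trans e0).
  by move=> x /H[/le_trans|//]; exact.
exists c; first by rewrite c0 (le_trans c1).
by move=> x /H[//|/le_trans]; exact.
Qed.

End PsiMax.

(** * The norm on the half-line and a bound for all intervals *)

Section Norms.
Set Implicit Arguments. Unset Strict Implicit.
Variables (R : realType) (alpha : R).
Hypotheses (alpha_gtN1 : -1 < alpha) (alpha_neq0 : alpha != 0).

Lemma relosc_ge0_le a b : 0 <= a -> a < b ->
  relosc (falpha alpha) a b <= GRplus_const alpha.
Proof.
move=> a0 ab; have b0 : 0 < b by exact: le_lt_trans ab.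
have t0 : 0 <= a / b by rewrite divr_ge0// ltW.
have t1 : a / b < 1 by rewrite ltr_pdivrMr// mul1r.
have [r _ s] := level_split_ge0 alpha_gtN1 t0 t1.
have := reloscZ alpha_gtN1 alpha_neq0 b0 s.
rewrite mulr1 mulrCA divff ?gt_eqF// mulr1 => ->.
by apply: relosc_unit_le => //; rewrite t0 t1.
Qed.

Lemma relosc_unit : relosc (falpha alpha) 0 1 = GRplus_const alpha.
Proof.
have [eta1 [e01 eE]] := eta1_exists alpha_gtN1 alpha_neq0.
by rewrite -[X in relosc _ X]oppr0 (relosc_psi _ _ e01)// ?psi0 ?mulr1// lexx ler01.
Qed.

Lemma GRnorm_Rplus : GRnorm (@Rplus R) (falpha alpha) = (GRplus_const alpha)%:E.
Proof.
apply/le_anti/andP; split.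
  apply: ge_ereal_sup => _ [[a b] /= [ab S] <-]; rewrite lee_fin relosc_ge0_le//.
  by apply: S; rewrite /= in_itv/= lexx ltW.
apply: ereal_sup_ubound; exists (0, 1) => /=; last by rewrite relosc_unit.
by split=> // x; rewrite /= in_itv/= => /andP[].
Qed.

Lemma relosc_le eta1 M a b : 0 < eta1 < 1 -> eta1_eq alpha eta1 ->
  (forall eta, 0 <= eta <= 1 -> psi alpha eta1 eta <= M) -> a < b ->
  relosc (falpha alpha) a b <= GRplus_const alpha * M.
Proof.
move=> e01 eE psiM ab.
have C0 := GRplus_const_gt0 alpha_gtN1 alpha_neq0.
(* The value 1 at [eta = 0] lets the half-line bound be absorbed into the general one. *)
have M1 : 1 <= M by rewrite -(psi0 alpha_gtN1 e01) psiM// lexx ler01.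
have le1 x y : 0 <= x -> x < y -> relosc (falpha alpha) x y <= GRplus_const alpha * M.
  by move=> x0 xy; rewrite (le_trans (relosc_ge0_le x0 xy))// ler_peMr// ltW.
(* Dilation by [y] reduces to [eta = x / y]; the split is kept for a later reflection. *)
have le2 x y : 0 <= x -> x <= y -> 0 < y ->
    (exists r c d, level_split alpha (- x) y r c d) /\
    relosc (falpha alpha) (- x) y <= GRplus_const alpha * M.
  move=> x0 xy y0.
  have h : 0 <= x / y <= 1.
    by rewrite divr_ge0 ?(ltW y0)//= ler_pdivrMr// mul1r.
  have [r [c [d s]]] := level_split_unit alpha_gtN1 alpha_neq0 e01 eE h.
  have xE : y * - (x / y) = - x by rewrite mulrN mulrCA divff ?mulr1// gt_eqF.
  split.
    exists (y * r), (y * c), (y * d).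
    by have := level_splitZ alpha_gtN1 y0 s; rewrite mulr1 xE.
  have := reloscZ alpha_gtN1 alpha_neq0 y0 s.
  rewrite mulr1 xE => ->; rewrite (relosc_psi _ _ e01)// ler_pM2l//.
  exact: psiM.
(* Cases by the position of 0: intervals on the left are reflected, and when 0 is interior the
   longer arm is brought to the right. *)
have [a0|a0] := leP 0 a; first exact: le1.
have [b0|b0] := leP b 0.
  have Nb0 : 0 <= - b by rewrite oppr_ge0.
  have Nab : - b < - a by rewrite ltrN2.
  have [r _ s] := level_split_ge0 alpha_gtN1 Nb0 Nab.
  have := reloscN alpha_gtN1 alpha_neq0 s; rewrite !opprK => ->.
  exact: le1.
have Na0 : 0 < - a by rewrite oppr_gt0.
have [aLb|/ltW bLa] := leP (- a) b.
  by have [_] := le2 _ _ (ltW Na0) aLb b0; rewrite opprK.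
have [[r [c [d s]]] le] := le2 _ _ (ltW b0) bLa Na0.
by have := reloscN alpha_gtN1 alpha_neq0 s; rewrite !opprK => ->.
Qed.

End Norms.

(** * The norm on the whole line, attained on [[-eta0, 1]] *)

Theorem theorem2p1 (R : realType) (alpha : R) :
  -1 < alpha -> alpha != 0 ->
  (exists eta1 : R, 0 < eta1 < 1 /\ eta1_eq alpha eta1) /\
  (forall eta1 : R, 0 < eta1 < 1 -> eta1_eq alpha eta1 ->
     exists eta0 : R, 0 <= eta0 <= 1 /\
       (forall eta : R, 0 <= eta <= 1 -> psi alpha eta1 eta <= psi alpha eta1 eta0) /\
       GRnorm setT (falpha alpha) =
         (GRnorm (@Rplus R) (falpha alpha) * (psi alpha eta1 eta0)%:E)%E).
Proof.
move=> aN1 a0; split; first exact: eta1_exists.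
move=> eta1 e01 eE; have [eta0 h0 hmax] := psi_max aN1 a0 e01 eE.
exists eta0; split=> //; split=> //.
rewrite GRnorm_Rplus// -EFinM; apply/le_anti/andP; split.
  apply: ge_ereal_sup => _ [[a b] /= [ab _] <-]; rewrite lee_fin.
  exact: relosc_le hmax ab.
apply: ereal_sup_ubound; exists (- eta0, 1) => /=; last by rewrite (relosc_psi _ _ e01).
split=> //; have /andP[e0 _] := h0.
by rewrite (le_lt_trans _ (@ltr01 R))// oppr_le0.
Qed.
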